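(* Let $G$ be an abelian group, $\mathcal{D}$ a finite-dimensional simple real associative algebra, and $\Gamma_0$ a division $G$-grading on $\mathcal{D}$ of type (2-b), i.e. $\mathcal{D}$ is isomorphic as a real algebra to $M_{n/2}(\mathbb{H})$ (with $n=2^m\geq2$) and the nonzero homogeneous components of $\Gamma_0$ have real dimension $2$. Let $T$ be the support of $\Gamma_0$, let $K=\operatorname{supp}(C_{\mathcal{D}}(\mathcal{D}_e))$, a subgroup of $T$ of index $2$, and let $\nu:T\setminus K\to\{\pm1\}$ be the associated map. Then the Weyl group of $\Gamma_0$ is $$W(\Gamma_0)=\operatorname{Aut}(T,K,\nu)=\{f\in\operatorname{Aut}(T)\mid f(K)=K\text{ and }\nu(f(u))=\nu(u)\ \forall u\in T\setminus K\}.$$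
   Context: A division $G$-grading on a unital algebra $\mathcal{D}$ is a grading $\mathcal{D}=\bigoplus_{g\in G}\mathcal{D}_g$ in which every nonzero homogeneous element is invertible; its support $T=\{g\mid\mathcal{D}_g\neq0\}$ is a subgroup of $G$. $C_{\mathcal{D}}(\mathcal{D}_e)$ is the centralizer in $\mathcal{D}$ of the identity component $\mathcal{D}_e\cong\mathbb{C}$. For type (2-b), $T$ is isomorphic to $\mathbb{Z}_2^{2m-1}$. For $u\in T\setminus K$ and any nonzero $X\in\mathcal{D}_u$, $X^2$ is a nonzero real multiple of the unity $I$ of $\mathcal{D}$ whose sign does not depend on $X$; $\nu(u)\in\{\pm1\}$ is this sign, i.e. $X^2\in\nu(u)\mathbb{R}_{>0}I$. $\operatorname{Aut}(\Gamma_0)$ is the group of $\mathbb{R}$-algebra automorphisms of $\mathcal{D}$ mapping each homogeneous component onto a homogeneous component; $\operatorname{Stab}(\Gamma_0)$ is the subgroup of those mapping each homogeneous component onto itself; $W(\Gamma_0)=\operatorname{Aut}(\Gamma_0)/\operatorname{Stab}(\Gamma_0)$, identified with a subgroup of $\operatorname{Aut}(T)$ by sending the class of $\psi$ to the map $f$ with $\psi(\mathcal{D}_t)=\mathcal{D}_{f(t)}$. *)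

(* Defs.v *)
From HB Require Import structures.
From mathcomp Require Import all_boot all_order all_algebra all_field.
From mathcomp Require Import ring boolp classical_sets functions reals.

Set Implicit Arguments.
Unset Strict Implicit.
Unset Printing Implicit Defensive.

Import Order.TTheory GRing.Theory Num.Theory.
Local Open Scope ring_scope.
Local Open Scope classical_set_scope.

Record quat (R : Type) := Quat { q1 : R; qi : R; qj : R; qk : R }.

Section QuatTheory.
Variable R : realType.
Implicit Types x y : quat R.

Definition tuple_of_quat x := (q1 x, qi x, qj x, qk x).
Definition quat_of_tuple (t : R * R * R * R) :=
  let: (a, b, c, d) := t in Quat a b c d.
Lemma tuple_of_quatK : cancel tuple_of_quat quat_of_tuple.
Proof. by case. Qed.
HB.instance Definition _ := Choice.copy (quat R) (can_type tuple_of_quatK).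

Definition quat0 : quat R := Quat 0 0 0 0.
Definition quat1 : quat R := Quat 1 0 0 0.
Definition quat_opp x := Quat (- q1 x) (- qi x) (- qj x) (- qk x).
Definition quat_add x y :=
  Quat (q1 x + q1 y) (qi x + qi y) (qj x + qj y) (qk x + qk y).
Definition quat_mul x y :=
  Quat (q1 x * q1 y - qi x * qi y - qj x * qj y - qk x * qk y)
       (q1 x * qi y + qi x * q1 y + qj x * qk y - qk x * qj y)
       (q1 x * qj y - qi x * qk y + qj x * q1 y + qk x * qi y)
       (q1 x * qk y + qi x * qj y - qj x * qi y + qk x * q1 y).
Definition quat_scale (a : R) x := Quat (a * q1 x) (a * qi x) (a * qj x) (a * qk x).

Lemma quat_ext x y : q1 x = q1 y -> qi x = qi y -> qj x = qj y ->
  qk x = qk y -> x = y.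
Proof. by case: x y => ? ? ? ? [? ? ? ?] /= -> -> -> ->. Qed.

Local Ltac quat_ring := repeat intro; apply: quat_ext => /=; ring.

Lemma quat_addA : associative quat_add. Proof. by quat_ring. Qed.
Lemma quat_addC : commutative quat_add. Proof. by quat_ring. Qed.
Lemma quat_add0 : left_id quat0 quat_add. Proof. by quat_ring. Qed.
Lemma quat_addN : left_inverse quat0 quat_opp quat_add.
Proof. by quat_ring. Qed.
HB.instance Definition _ :=
  GRing.isZmodule.Build (quat R) quat_addA quat_addC quat_add0 quat_addN.

Lemma quat_mulA : associative quat_mul. Proof. by quat_ring. Qed.
Lemma quat_mul1l : left_id quat1 quat_mul. Proof. by quat_ring. Qed.
Lemma quat_mul1r : right_id quat1 quat_mul. Proof. by quat_ring. Qed.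
Lemma quat_mulDl : left_distributive quat_mul quat_add.
Proof. by quat_ring. Qed.
Lemma quat_mulDr : right_distributive quat_mul quat_add.
Proof. by quat_ring. Qed.
Lemma quat1_neq0 : quat1 != quat0.
Proof. by apply/eqP => -[] /eqP; rewrite oner_eq0. Qed.
HB.instance Definition _ := GRing.Zmodule_isNzRing.Build (quat R)
  quat_mulA quat_mul1l quat_mul1r quat_mulDl quat_mulDr quat1_neq0.

Lemma quat_scaleA a b x :
  quat_scale a (quat_scale b x) = quat_scale (a * b) x.
Proof. by quat_ring. Qed.
Lemma quat_scale1 : left_id 1 quat_scale. Proof. by quat_ring. Qed.
Lemma quat_scaleDr : right_distributive quat_scale +%R.
Proof. by quat_ring. Qed.
Lemma quat_scaleDl x : {morph quat_scale^~ x : a b / a + b}.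
Proof. by quat_ring. Qed.
HB.instance Definition _ := GRing.Zmodule_isLmodule.Build R (quat R)
  quat_scaleA quat_scale1 quat_scaleDr quat_scaleDl.

Lemma quat_scaleAl a x y : a *: (x * y) = (a *: x) * y.
Proof. by quat_ring. Qed.
HB.instance Definition _ :=
  GRing.Lmodule_isLalgebra.Build R (quat R) quat_scaleAl.
Lemma quat_scaleAr a x y : a *: (x * y) = x * (a *: y).
Proof. by quat_ring. Qed.
HB.instance Definition _ :=
  GRing.Lalgebra_isAlgebra.Build R (quat R) quat_scaleAr.

End QuatTheory.

(* 'M[quat R]_k carries only the scaling by quat R in the library; the real
   scalar a acts on it as the central quaternion a%:A. *)
Definition iso_quat_matrix (R : realType) (D : falgType R) (k : nat) : Prop :=
  exists f : D -> 'M[quat R]_k,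
    [/\ bijective f,
        {morph f : x y / x + y},
        forall (a : R) (x : D), f (a *: x) = (a%:A : quat R) *: f x,
        f 1 = 1%:M &
        forall x y : D, f (x * y) = f x *m f y].

(* D is unital, so its two-sided ideals are subspaces; D <> 0 by falgType. *)
Definition simple_alg (R : realType) (D : falgType R) : Prop :=
  forall I : {vspace D}, (fullv * I <= I)%VS -> (I * fullv <= I)%VS ->
    I = 0%VS \/ I = fullv.

(* G is not assumed finite: the directness of the sum of the components is
   expressed through finite families of distinct degrees. *)
Definition is_grading (R : realType) (G : zmodType) (D : falgType R)
    (Gam : G -> {vspace D}) : Prop :=
  [/\ forall g h : G, (Gam g * Gam h <= Gam (g + h)%R)%VS,
      forall x : D, exists (s : seq G) (c : G -> D),
        (forall g, c g \in Gam g) /\ x = \sum_(g <- s) c g &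
      forall (s : seq G) (c : G -> D), uniq s -> (forall g, c g \in Gam g) ->
        \sum_(g <- s) c g = 0 -> forall g, g \in s -> c g = 0].

Record div_grading (R : realType) (G : zmodType) (D : falgType R) := DivGrading {
  component :> G -> {vspace D};
  _ : is_grading component;
  _ : forall (g : G) (x : D), x \in component g -> x != 0 -> x \is a GRing.unit
}.
Arguments div_grading {R} G D.

Section DivGradingTheory.
Variables (R : realType) (G : zmodType) (D : falgType R).
Variable Gam : div_grading G D.

Lemma div_grading_grading : is_grading Gam. Proof. by case: Gam. Qed.

Lemma div_grading_unit g x : x \in Gam g -> x != 0 -> x \is a GRing.unit.
Proof. by case: Gam g x. Qed.

Lemma gradM g h x y : x \in Gam g -> y \in Gam h -> x * y \in Gam (g + h).
Proof.
by move=> xg yh; case: div_grading_grading => /(_ g h)/subvP s _ _;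
  apply/s/memv_mul.
Qed.

Lemma grad_dec h x : exists (s : seq G) (c : G -> D),
  [/\ uniq s, h \in s, forall g, c g \in Gam g & x = \sum_(g <- s) c g].
Proof.
have [_ /(_ x)[s [c [cG ->]]] _] := div_grading_grading.
exists (undup (h :: s)), (fun g => c g *+ count_mem g s); split.
- exact: undup_uniq.
- by rewrite mem_undup mem_head.
- by move=> g; apply: rpredMn.
rewrite -[LHS](big_undup_iterop_count _ s xpredT c) /=.
rewrite [RHS](bigID (mem s)) /= [X in _ + X]big1 ?addr0; last first.
  by move=> g gs; rewrite (count_memPn gs) mulr0n.
rewrite -[RHS]big_filter [LHS](perm_big [seq g <- undup (h :: s) | g \in s]).
  by apply: eq_bigr => g _; rewrite Monoid.iteropE GRing.iter_addr addr0.
apply: uniq_perm; rewrite ?undup_uniq ?filter_uniq ?undup_uniq //.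
move=> g; rewrite mem_filter !mem_undup inE.
by case: (g \in s); rewrite ?orbT.
Qed.

Lemma grad_inj g h x : x \in Gam g -> x \in Gam h -> x != 0 -> g = h.
Proof.
move=> xg xh x0; apply: contraTeq isT => /= gh; exfalso.
have [_ _ ind] := div_grading_grading.
pose c k := if k == g then x else if k == h then - x else 0.
have /eqP := x0; apply; suff: c g = 0 by rewrite /c eqxx.
apply: (ind [:: g; h]); rewrite ?mem_head //= ?inE ?gh //.
  move=> k; rewrite /c; case: eqP => [->//|_].
  by case: eqP => [->|_]; rewrite ?rpredN ?rpred0.
by rewrite !big_cons big_nil /c eqxx eq_sym (negPf gh) eqxx addr0 subrr.
Qed.

Lemma grad_shift g h x y :
  x != 0 -> x \in Gam g -> x * y \in Gam h -> y \in Gam (h - g).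
Proof.
move=> x0 xg xyh; have ux := div_grading_unit xg x0.
have [s [c [us hs cG Ey]]] := grad_dec (h - g) y.
have [_ _ ind] := div_grading_grading.
pose d k := x * c (k - g) - (if k == h then x * y else 0).
have d0 : forall k, k \in [seq k + g | k <- s] -> d k = 0.
  apply: ind; first by rewrite map_inj_uniq //; apply: addIr.
    move=> k; rewrite /d rpredB //.
      by rewrite -{2}(subrK g k) [_ - g + g]addrC; apply: gradM.
    by case: eqP => [->|_] //; rewrite rpred0.
  rewrite sumrB big_map; under eq_bigr do rewrite addrK.
  have hS : h \in [seq k + g | k <- s].
    by apply/mapP; exists (h - g); rewrite ?subrK.
  rewrite -mulr_sumr -Ey [X in _ - X](bigD1_seq h) ?map_inj_uniq //=.
    by rewrite eqxx big1 ?addr0 ?subrr // => k /negPf ->.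
  exact: addIr.
have Ek k : k \in s -> k != h - g -> c k = 0.
  move=> ks kh; have := d0 (k + g) (map_f _ ks).
  have kgh : k + g != h by apply: contraNneq kh => <-; rewrite addrK.
  rewrite /d addrK (negPf kgh) subr0 => /(congr1 ( *%R x^-1)).
  by rewrite mulKr // mulr0.
rewrite Ey (bigD1_seq (h - g)) //= big_seq_cond big1 ?addr0 //.
by move=> k /andP[]; apply: Ek.
Qed.

Definition supp : pred G := fun g => Gam g != 0%VS.

Lemma suppP g : reflect (exists2 x, x \in Gam g & x != 0) (g \in supp).
Proof.
apply: (iffP idP) => [g0|[x xg x0]].
  by exists (vpick (Gam g)); rewrite ?memv_pick ?vpick0.
by apply: contra x0 => /eqP g0; move: xg; rewrite g0 memv0.
Qed.

Lemma supp_zmod_closed : zmod_closed supp.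
Proof.
have sB g h : g \in supp -> h \in supp -> h - g \in supp.
  move=> /suppP[x xg x0] /suppP[y yh y0]; have ux := div_grading_unit xg x0.
  have Exy : x * (x^-1 * y) = y by rewrite mulVKr.
  apply/suppP; exists (x^-1 * y); first by apply: grad_shift x0 xg _; rewrite Exy.
  by apply: contraNneq y0 => xy0; rewrite -Exy xy0 mulr0.
split; last by move=> g h gs hs; apply: sB.
have [s [c [_ _ cG E1]]] := grad_dec 0 1.
have [g gs c0] : exists2 g, g \in s & c g != 0.
  apply/hasP; apply: contraT => /hasPn c0; move: E1.
  rewrite big_seq_cond big1 => [/eqP|g]; first by rewrite oner_eq0.
  by rewrite andbT => /c0; rewrite negbK => /eqP.
have gS : g \in supp by apply/suppP; exists (c g).
by rewrite -(subrr g); apply: sB.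
Qed.

HB.instance Definition _ := GRing.isZmodClosed.Build G supp supp_zmod_closed.

Record supp_type := SuppType { supp_val :> G; _ : supp_val \in supp }.
HB.instance Definition _ := [isSub for supp_val].
HB.instance Definition _ := [Choice of supp_type by <:].
HB.instance Definition _ := [SubChoice_isSubZmodule of supp_type by <:].

(* supp (C_D(D_e)) *)
Definition suppK : set supp_type :=
  [set t : supp_type | ('C(Gam 0%R) :&: Gam t)%VS != 0%VS].

(* The sign s with X^2 in s R_{>0} for all nonzero X in D_u; only relevant for
   u outside K (the default 0 stands for the absence of such a sign). *)
Definition nu (u : supp_type) : int :=
  xget 0 [set s : int | (s = 1 \/ s = -1) /\
    forall X : D, X \in Gam u -> X != 0 ->
      exists2 r : R, 0 < r & X ^+ 2 = (s%:~R * r)%:A].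

Definition autT : set (supp_type -> supp_type) :=
  [set f : supp_type -> supp_type | bijective f /\ {morph f : s t / s + t}].

Definition autTKnu : set (supp_type -> supp_type) :=
  [set f : supp_type -> supp_type | [/\ autT f, f @` suppK = suppK &
               forall u, ~ suppK u -> nu (f u) = nu u]].

Definition autGam : set 'AEnd(D) :=
  [set psi : 'AEnd(D) | bijective psi /\
    forall g : G, exists h : G, (psi @: Gam g)%VS = Gam h].

Definition stabGam : set 'AEnd(D) :=
  [set psi : 'AEnd(D) | bijective psi /\ forall g : G, (psi @: Gam g)%VS = Gam g].

Definition stab_coset (psi : 'AEnd(D)) : set 'AEnd(D) :=
  [set (psi \o sigma)%AF | sigma in stabGam].

(* The quotient Aut / Stab, as the set of cosets of Stab *)
Definition weyl : set (set 'AEnd(D)) := stab_coset @` autGam.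

Definition weyl_acts (w : set 'AEnd(D)) (f : supp_type -> supp_type) : Prop :=
  forall psi : 'AEnd(D), w psi ->
    forall t : supp_type, (psi @: Gam t)%VS = Gam (f t).

End DivGradingTheory.

Arguments autT {R G D} Gam _.
Arguments autTKnu {R G D} Gam _.
Arguments weyl {R G D} Gam _.

Section WeylTheory.
Variables (R : realType) (G : zmodType) (D : falgType R).
Variable Gam : div_grading G D.

Lemma supp_neq0 (t : supp_type Gam) : exists2 x, x \in Gam t & x != 0.
Proof. by apply/suppP; case: t. Qed.

Lemma component_inj (s t : supp_type Gam) : Gam s = Gam t -> s = t.
Proof.
have [x xs x0] := supp_neq0 s; move=> Est; apply: val_inj => /=.
have xt : x \in Gam t by rewrite -Est.
exact: grad_inj xs xt x0.
Qed.

Lemma limg_aend_inj (psi : 'AEnd(D)) (U V : {vspace D}) : bijective psi ->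
  (psi @: U)%VS = (psi @: V)%VS -> U = V.
Proof.
move=> [phi psiK _] EUV; apply/vspaceP => x.
have H W : (psi x \in (psi @: W)%VS) = (x \in W).
  apply/idP/idP => [/memv_imgP[y yW /(can_inj psiK)->] //|].
  exact: memv_img.
by rewrite -H EUV H.
Qed.

Lemma weyl_acts_exists w : weyl Gam w ->
  exists2 f : supp_type Gam -> supp_type Gam, autT Gam f & weyl_acts w f.
Proof.
move=> [psi [psi_bij /choice[F FE]] <-].
have FS g : (F g \in supp Gam) = (g \in supp Gam).
  rewrite !unfold_in /supp -FE; congr (~~ _); apply/eqP/eqP => [E|->].
    by apply: (limg_aend_inj psi_bij); rewrite E limg0.
  by rewrite limg0.
have FT (t : supp_type Gam) : F t \in supp Gam by rewrite FS; case: t.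
pose f (t : supp_type Gam) := SuppType (FT t).
have fE (t : supp_type Gam) : (psi @: Gam t)%VS = Gam (f t) by rewrite FE.
exists f; last first.
  by move=> _ [sig [_ sigE] <-] t; rewrite limg_comp sigE.
have f_inj : injective f.
  move=> s t Est; apply: component_inj; apply: (limg_aend_inj psi_bij).
  by rewrite !fE Est.
split.
  have f_surj (t : supp_type Gam) : exists s, f s = t.
    have [x xt x0] := supp_neq0 t; have [phi _ phiK] := psi_bij.
    have [l [c [ul _ cG Ey]]] := grad_dec Gam 0 (phi x).
    have Ft : (t : G) \in [seq F g | g <- l].
      apply: contraNT x0 => Ft; have [_ _ ind] := div_grading_grading Gam.
      pose e k := if k == t :> G then x
                  else - \sum_(g <- l | F g == k) psi (c g).
      suff : e t = 0 by rewrite /e eqxx => ->.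
      apply: (ind ((t : G) :: undup [seq F g | g <- l]) e _ _ _ (t : G)) => [|k||].
      - by rewrite /= mem_undup Ft undup_uniq.
      - rewrite /e; case: eqP => [->//|_]; rewrite rpredN rpred_sum // => g.
        by move/eqP<-; rewrite -FE memv_img.
      - rewrite big_cons {1}/e eqxx (eq_big_seq (fun k =>
          - \sum_(g <- l | F g == k) psi (c g))); last first.
          move=> k; rewrite mem_undup /e => kF; case: eqP => // kt.
          by rewrite -kt kF in Ft.
        rewrite sumrN; apply/eqP; rewrite subr_eq0; apply/eqP.
        under eq_bigr do rewrite big_mkcond /=.
        rewrite exchange_big /= -{1}[x]phiK Ey linear_sum /=.
        apply: eq_big_seq => g gl.
        rewrite (bigD1_seq (F g)) ?undup_uniq ?mem_undup ?map_f //= eqxx.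
        by rewrite big1 ?addr0 // => k; rewrite eq_sym => /negPf->.
      - exact: mem_head.
    have [g _ tE] := mapP Ft.
    have gS : g \in supp Gam by rewrite -FS -tE; case: (t).
    by exists (SuppType gS); apply: val_inj.
  have [f' f'K] := choice f_surj.
  by exists f' => // s; apply: f_inj; rewrite f'K.
move=> s t; apply: val_inj => /=.
have [[x xs x0] [y yt y0]] := (supp_neq0 s, supp_neq0 t).
apply: (@grad_inj _ _ _ Gam _ _ (psi (x * y))).
- by rewrite -FE memv_img // gradM.
- by rewrite rmorphM gradM // -FE memv_img.
have ux := div_grading_unit xs x0.
have xy0 : x * y != 0.
  by apply: contraNneq y0 => xy0; rewrite -(mulKr ux y) xy0 mulr0.
apply: contraNneq xy0 => pxy0; apply/eqP/(bij_inj psi_bij).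
by rewrite pxy0 linear0.
Qed.

Lemma aend_inv (psi : 'AEnd(D)) : bijective psi ->
  exists phi : 'AEnd(D), cancel psi phi /\ cancel phi psi.
Proof.
move=> psi_bij; have ker0 : lker psi == 0%VS by apply/lker0P/bij_inj.
have fK : cancel psi (psi^-1)%VF := lker0_lfunK ker0.
have Kf : cancel (psi^-1)%VF psi := lker0_lfunVK ker0.
have phiP : ahom_in {:D} (psi^-1)%VF.
  apply/ahom_inP; split=> [x y _ _|]; apply: (bij_inj psi_bij).
    by rewrite Kf rmorphM /= !Kf.
  by rewrite Kf; exact/esym/rmorph1.
by exists (AHom phiP).
Qed.

Lemma aend_compE (f g : 'AEnd(D)) x : (f \o g)%AF x = f (g x).
Proof. exact: comp_lfunE. Qed.

Lemma aend_ext (f g : 'AEnd(D)) : f =1 g -> f = g.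
Proof. by case: f g => f ? [g ?] /lfunP /= Efg; apply: val_inj. Qed.

Lemma weyl_acts_sub w w' (f : supp_type Gam -> supp_type Gam) :
  weyl Gam w -> weyl Gam w' ->
  weyl_acts w f -> weyl_acts w' f -> w `<=` w'.
Proof.
move=> [psi [psi_bij _] <-] [psi' [psi'_bij _] <-] actw actw'.
have [phi [psiK phiK]] := aend_inv psi'_bij.
move=> _ [sig sigS <-]; exists (phi \o (psi \o sig))%AF; last first.
  by apply: aend_ext => x; rewrite !aend_compE phiK.
have psi'w : stab_coset Gam psi' psi'.
  exists \1%AF; last by apply: aend_ext => x; rewrite aend_compE id_lfunE.
  split; last by move=> g; rewrite lim1g.
  by exists id => x; rewrite id_lfunE.
have psiw : stab_coset Gam psi (psi \o sig)%AF by exists sig.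
split.
  apply: (@eq_bij _ _ (phi \o (psi \o sig))) => [|x]; last first.
    by rewrite !aend_compE.
  apply: bij_comp; first by exists psi'.
  by apply: bij_comp => //; case: sigS.
move=> g; have [gS|] := boolP (g \in supp Gam); last first.
  by rewrite negbK => /eqP->; rewrite limg0.
have Eg : ((psi \o sig)%AF @: Gam g)%VS = (psi' @: Gam g)%VS.
  by rewrite (actw _ psiw (SuppType gS)) (actw' _ psi'w (SuppType gS)).
rewrite limg_comp [X in (_ @: X)%VS]Eg -limg_comp -[RHS]lim1g.
by congr (_ @: _)%VS; apply/lfunP => x; rewrite comp_lfunE psiK id_lfunE.
Qed.

Lemma weyl_acts_inj w w' (f : supp_type Gam -> supp_type Gam) :
  weyl Gam w -> weyl Gam w' ->
  weyl_acts w f -> weyl_acts w' f -> w = w'.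
Proof.
by move=> ww ww' wf w'f; apply/seteqP; split;
  apply: weyl_acts_sub; eassumption.
Qed.

(* The image in Aut(T) of Aut / Stab: by weyl_acts_exists and weyl_acts_inj,
   weyl_acts embeds weyl Gam into autT. *)
Definition weyl_aut : set (supp_type Gam -> supp_type Gam) :=
  [set f | exists2 w, weyl Gam w & weyl_acts w f].

End WeylTheory.

Arguments weyl_aut {R G D} Gam _.

(* Main.v *)
Require Import Defs.
From HB Require Import structures.
From mathcomp Require Import all_boot all_order all_algebra all_field.
From mathcomp Require Import ring lra boolp classical_sets functions reals.

(** An automorphism inducing f maps D_e and hence its centralizer to itself, and
    it preserves the signs of squares, so f preserves K and nu.

    Conversely, let f preserve K and nu, write D_e = R + R I with I^2 = -1, and
    fix u outside K and X in D_u with X^2 = nu(u); X anticommutes with I.  The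
    element X^2 is central: conjugation by it multiplies a homogeneous element
    commuting with I by a positive real number, equal to 1 because T is torsion.  Hence each D_k,
    k in K, contains a Z_k commuting with I and X, and Z_k^2 may be normalized
    to nu(u) nu(u + k).  These signs determine all commutation signs between the
    generators I, X, Z_k, and they agree with those of the analogous generators
    I, X', Z'_(f k) built from f(u).

    The maps v |-> y v x, for (x, y) ranging over corresponding generators, thus
    are commuting operators of square 1 on D, and have a common eigenvector v.
    Then v D is contained in D v, a nonzero two-sided ideal, so v is invertible
    by simplicity, and conjugation by v is an automorphism inducing f. *)

Set Implicit Arguments.
Unset Strict Implicit.
Unset Printing Implicit Defensive.

Import Order.TTheory GRing.Theory Num.Theory.
Local Open Scope ring_scope.
Local Open Scope classical_set_scope.

(** * The center of a quaternionic matrix algebra *)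

Lemma quat_center (R : realType) (q : quat R) :
  (forall p, q * p = p * q) -> exists a : R, q = a%:A.
Proof.
case: q => a b c d qC; exists a.
have := qC (Quat 0 1 0 0); have := qC (Quat 0 0 1 0).
case=> h1 h2 h3 h4; case=> k1 k2 k3 k4.
by apply: quat_ext => /=; lra.
Qed.

(** Compare [f z] with the matrix [N] whose only nonzero entry is [q] at [(j, 0)]. In the resulting
    equation [E], taking [q = 1] shows that [f z] is a scalar matrix, and [i = j = 0] that its
    diagonal entry is a central quaternion. *)
Lemma iso_quat_matrix_center (R : realType) (D : falgType R) (k : nat) :
  (0 < k)%N -> iso_quat_matrix D k ->
  forall z : D, (forall x, z * x = x * z) -> exists a : R, z = a%:A.
Proof.
case: k => // k _ [f [[g fK gK] fD fZ f1 fM]] z zC.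
have MC (N : 'M[quat R]_k.+1) : f z *m N = N *m f z.
  by rewrite -(gK N) -!fM zC.
have E (i j : 'I_k.+1) (q : quat R) : f z i j * q = (q *+ (i == j)) * f z 0 0.
  pose N : 'M[quat R]_k.+1 := \matrix_(a, b) (q *+ ((a == j) && (b == 0))).
  have /matrixP /(_ i 0) := MC N.
  rewrite !mxE (bigD1 j) //= big1 => [|l lj]; last first.
    by rewrite !mxE (negPf lj) mulr0.
  rewrite !mxE !eqxx addr0 => ->.
  rewrite (bigD1 0) //= big1 => [|l l0]; last first.
    by rewrite !mxE (negPf l0) andbF mul0r.
  by rewrite !mxE eqxx andbT addr0.
have [a Ea] : exists a : R, f z 0 0 = a%:A.
  by apply: quat_center => p; rewrite E eqxx.
exists a; apply: (can_inj fK); rewrite fZ f1; apply/matrixP => i j.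
have := E i j 1; rewrite mulr1 => ->; rewrite !mxE Ea.
by case: (i == j); rewrite ?mulr1n ?mulr0n ?mul1r ?mulr1 ?mul0r ?mulr0.
Qed.

(** * Homogeneous elements and finiteness of the support *)

Section GradingTheory.
Variables (R : realType) (G : zmodType) (D : falgType R).
Variable Gam : div_grading G D.

Lemma grad1 : 1 \in Gam 0.
Proof.
have /suppP[x x0 xN0] := (supp_zmod_closed Gam).1.
by rewrite -(subrr 0); apply: (grad_shift xN0 x0); rewrite mulr1.
Qed.

Lemma gradA (a : R) : a%:A \in Gam 0.
Proof. by rewrite memvZ ?grad1. Qed.

Lemma gradV g x : x \in Gam g -> x != 0 -> x^-1 \in Gam (- g).
Proof.
move=> xg x0; rewrite -sub0r; apply: (grad_shift x0 xg).
by rewrite divrr; [apply: grad1 | exact: (div_grading_unit xg)].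
Qed.

Lemma gradM_neq0 g x y : x \in Gam g -> x != 0 -> y != 0 -> x * y != 0.
Proof.
move=> xg x0; apply: contraNneq => xy0.
by rewrite -(mulKr (div_grading_unit xg x0) y) xy0 mulr0.
Qed.

Lemma grad_ind (P : D -> Prop) : P 0 -> (forall x y, P x -> P y -> P (x + y)) ->
  (forall g x, x \in Gam g -> x != 0 -> P x) -> forall x, P x.
Proof.
move=> P0 PD PG x; have [s [c [_ _ cG ->]]] := grad_dec Gam 0 x.
elim/big_ind: _ => // g _.
by have [->//|] := eqVneq (c g) 0; apply: PG.
Qed.

(** Since the sum of the components is direct, nonzero elements picked from distinct components are
    linearly independent. *)
Lemma size_supp (s : seq G) : uniq s -> {subset s <= supp Gam} ->
  (size s <= \dim {:D})%N.
Proof.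
move=> us sS; pose c g := vpick (Gam g).
have cG g : c g \in Gam g by apply: memv_pick.
have [_ _ ind] := div_grading_grading Gam.
have fr : free (map_tuple c (in_tuple s)).
  apply/freeP => /= k Hk i.
  (* Directness is stated for families indexed by all of [G], so the coefficients are extended by 0
     outside [s]. *)
  pose K g := if insub (index g s) is Some j then k j else 0.
  have KE (j : 'I_(size s)) : K s`_j = k j by rewrite /K index_uniq ?valK.
  have Kc g : g \in s -> K g *: c g = 0.
    apply: (ind s (fun g => K g *: c g)) => // [h|]; first by rewrite memvZ.
    rewrite -[RHS]Hk (big_nth 0) big_mkord; apply: eq_bigr => j _.
    by rewrite KE (nth_map 0).
  have := Kc _ (mem_nth 0 (ltn_ord i)).
  rewrite KE => /eqP; rewrite scaler_eq0 vpick0.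
  have := sS _ (mem_nth 0 (ltn_ord i)); rewrite unfold_in /supp => /negPf->.
  by rewrite orbF => /eqP.
have /eqP <- : size (map_tuple c (in_tuple s)) == size s by rewrite size_map.
by rewrite -(eqnP fr) dimvS ?subvf.
Qed.

(** Duplicate-free lists in the support have bounded size, and one of maximal size exhausts the
    support. *)
Lemma supp_finite : exists s : seq G, s =i supp Gam.
Proof.
pose P n := `[< exists s : seq G,
  [/\ uniq s, {subset s <= supp Gam} & size s = n] >].
have exP : exists n, P n by exists 0%N; apply/asboolP; exists [::].
have ubP n : P n -> (n <= \dim {:D})%N.
  by case/asboolP => s [us sS <-]; apply: size_supp.
case: (ex_maxnP exP ubP) => n /asboolP[s [us sS sn]] nmax.
exists s => g; apply/idP/idP => [/sS //|gS]; apply: contraT => gs.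
have /nmax : P n.+1.
  apply/asboolP; exists (g :: s); rewrite /= gs us sn; split=> //.
  by move=> h; rewrite inE => /orP[/eqP->|/sS].
by rewrite ltnn.
Qed.

(** Pigeonhole: the support is closed under multiples, and [d] exceeds its possible size by
    [size_supp]. *)
Lemma supp_torsion g : g \in supp Gam -> exists2 n, (0 < n)%N & g *+ n = 0.
Proof.
move=> gS; pose d := (\dim {:D}).+1.
have nS n : g *+ n \in supp Gam by rewrite rpredMn.
have /uniqPn : ~~ uniq (mkseq (fun n => g *+ n) d).
  apply: contraT => /negPn us.
  suff /(size_supp us) : {subset mkseq (fun n => g *+ n) d <= supp Gam}.
    by rewrite size_mkseq ltnn.
  by move=> _ /mapP[n _ ->].
move=> /(_ 0)[i [j [ij]]]; rewrite size_mkseq => jd.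
rewrite !nth_mkseq ?(ltn_trans ij) // => Eij.
exists (j - i)%N; first by rewrite subn_gt0.
by rewrite mulrnBr 1?ltnW // Eij subrr.
Qed.

End GradingTheory.

(** Left multiplication by [v] is injective, hence surjective in finite dimension, so [v] also has a
    right inverse. *)
Lemma falg_left_inv_unit (K : fieldType) (A : falgType K) (u v : A) :
  u * v = 1 -> v \is a GRing.unit.
Proof.
move=> uv1; have ker0 : lker (amull v) == 0%VS.
  apply/lker0P => x y; rewrite !lfunE /= => /(congr1 ( *%R u)).
  by rewrite !mulrA uv1 !mul1r.
have := lker0_lfunVK ker0 1; move: ((amull v)^-1%VF 1) => w.
rewrite lfunE /= => vw1.
suff uw : u = w by apply/unitrP; exists w; rewrite -{1}uw.
by rewrite -[u]mulr1 -vw1 mulrA uv1 mul1r.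
Qed.

(** * Intertwiners of sign-commuting families *)

(** The operators [v |-> p.2 * v * p.1] are involutions, because the sign of the squares enters
    twice, and they commute, because the exchange sign enters twice. Induction on [S] projects a
    common eigenvector of the tail onto an eigenspace of the head. *)
Lemma twisted_eigenvector (K : fieldType) (A : falgType K) (S : seq (A * A)) :
    (forall p, p \in S -> exists e : K,
       [/\ e ^+ 2 = 1, p.1 * p.1 = e%:A & p.2 * p.2 = e%:A]) ->
    (forall p q, p \in S -> q \in S -> exists e : K,
       [/\ e ^+ 2 = 1, p.1 * q.1 = e *: (q.1 * p.1) &
           p.2 * q.2 = e *: (q.2 * p.2)]) ->
  exists2 v : A, v != 0 &
    forall p, p \in S -> exists2 e : K, e ^+ 2 = 1 & p.2 * v = e *: (v * p.1).
Proof.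
elim: S => [|p S IH] sq comm; first by exists 1; rewrite ?oner_eq0.
have [||v v0 vS] := IH.
- by move=> q qS; apply: sq; rewrite inE qS orbT.
- by move=> q r qS rS; apply: comm; rewrite inE ?qS ?rS orbT.
have [e [e2 p11 p22]] := sq p (mem_head _ _).
(* The vector [v + p.2 * v * p.1] is fixed by the involution of [p]; if it vanishes, [v] has
   eigenvalue -1. Multiplying by [p.1] on the right turns these eigenvalues 1 and -1 into the signs
   [e] and [- e]. *)
have [w0|w0] := eqVneq (v + p.2 * v * p.1) 0.
  exists v => // q; rewrite inE => /orP[/eqP->|]; last exact: vS.
  exists (- e); rewrite ?sqrrN // scaleNr -scalerN.
  have /(congr1 ( *%R^~ p.1)) : p.2 * v * p.1 = - v.
    by apply/eqP; rewrite -addr_eq0 addrC w0.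
  rewrite /= -mulrA p11 -scalerAr mulr1 mulNr => <-.
  by rewrite scalerA -expr2 e2 scale1r.
exists (v + p.2 * v * p.1) => // q; rewrite inE => /orP[/eqP->|qS].
  exists e => //.
  have -> : p.2 * (v + p.2 * v * p.1) = p.2 * v + e *: (v * p.1).
    by rewrite mulrDr !mulrA p22 mulr_algl -scalerAl.
  have -> : (v + p.2 * v * p.1) * p.1 = v * p.1 + e *: (p.2 * v).
    by rewrite mulrDl -[in X in _ + X]mulrA p11 mulr_algr.
  by rewrite scalerDr scalerA -expr2 e2 scale1r addrC.
have [e' e'2 qv] := vS q qS; exists e' => //.
have [||s [s2 q1p1 q2p2]] := comm q p; rewrite ?inE ?eqxx ?qS ?orbT //.
rewrite mulrDr mulrDl scalerDr qv; congr (_ + _).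
rewrite !mulrA q2p2 -!scalerAl -(mulrA p.2 q.2 v) qv -scalerAr -scalerAl.
rewrite !mulrA -(mulrA (p.2 * v) q.1) q1p1 -scalerAr mulrA !scalerA.
by rewrite mulrAC -expr2 s2 mul1r.
Qed.

(** The left ideal [D v] is also a right ideal since [v D] lies in [D v]; simplicity makes it all of
    [D], which gives a left inverse of [v]. *)
Lemma simple_twisted_unit (R : realType) (D : falgType R) (v : D) :
  simple_alg D -> v != 0 -> (forall d, exists b, v * d = b * v) ->
  v \is a GRing.unit.
Proof.
move=> simD v0 vD; pose I := limg (amulr v).
have inI d : d * v \in I by apply/memv_imgP; exists d; rewrite ?memvf ?lfunE.
have [|| I0 | IT] := simD I.
- apply/prodvP => d _ _ /memv_imgP[b _ ->]; rewrite lfunE /= mulrA; exact: inI.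
- apply/prodvP => _ d /memv_imgP[b _ ->] _; rewrite lfunE /= -mulrA.
  by have [c ->] := vD d; rewrite mulrA; apply: inI.
- by have := inI 1; rewrite I0 memv0 mul1r (negPf v0).
have : 1 \in I by rewrite IT memvf.
by case/memv_imgP => d _; rewrite lfunE /= => /esym/falg_left_inv_unit.
Qed.

(** * The structure of the grading *)

Section IdentityComponent.
Variables (R : realType) (G : zmodType) (D : falgType R).
Variable Gam : div_grading G D.

(** Any [y] outside the real line satisfies a quadratic equation over the reals. A real root would
    produce zero divisors among homogeneous elements, so completing the square and rescaling gives a
    square root of -1. *)
Lemma identity_component_complex : \dim (Gam 0%R) = 2%N ->
  exists I, [/\ I \in Gam 0, I * I = - 1 &
    forall x, x \in Gam 0 -> exists p q : R, x = p%:A + q *: I].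
Proof.
move=> dim0.
have [y y0 yN1] : exists2 y, y \in Gam 0 & y \notin <[1 : D]>%VS.
  have : ~~ (Gam 0%R <= <[1%R : D]>)%VS.
    by apply/negP => /dimvS; rewrite dim0 dimv1.
  by case/subvPn => y; exists y.
have fr : free [:: y; 1].
  by rewrite free_cons span_seq1 yN1 seq1_free oner_eq0.
have Gam0E : <<[:: y; 1%R]>>%VS = Gam 0%R.
  apply/eqP; rewrite eqEdim (eqnP fr) dim0 leqnn andbT.
  by apply/span_subvP => z; rewrite !inE => /orP[]/eqP->; rewrite ?grad1.
have yP x : x \in Gam 0 -> exists p q : R, x = p%:A + q *: y.
  rewrite -Gam0E span_cons span_seq1 => /memv_addP[_ /vlineP[q ->]].
  by case=> _ /vlineP[p ->] ->; exists p, q; rewrite addrC.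
have [b [a yy]] : exists b a : R, y * y = b%:A + a *: y.
  by apply: yP; have := gradM y0 y0; rewrite addr0.
have shiftN0 (c : R) : y - c%:A != 0.
  by apply: contraNneq yN1 => /subr0_eq->; rewrite memvZ ?memv_line.
have shift0 (c : R) : y - c%:A \in Gam 0 by rewrite rpredB ?gradA.
have shiftM (c d : R) :
    (y - c%:A) * (y - d%:A) = (b + c * d)%:A + (a - c - d) *: y.
  rewrite mulrBr !mulrBl !mulr_algr mulr_algl yy scalerA (mulrC d) opprB.
  rewrite !scalerBl !scalerDl -!addrA; congr (_ + _).
  by rewrite [RHS]addrCA; congr (_ + _); rewrite addrCA.
(* This is the square of [y - (a / 2)%:A]. *)
pose c := b + a ^+ 2 / 4.
have c_lt0 : c < 0.
  rewrite ltNge; apply/negP => /sqr_sqrtr c2; pose s := Num.sqrt c.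
  have := gradM_neq0 (shift0 (a / 2 + s)) (shiftN0 _) (shiftN0 (a / 2 - s)).
  rewrite shiftM.
  have -> : b + (a / 2 + s) * (a / 2 - s) = 0.
    have -> : b + (a / 2 + s) * (a / 2 - s) = c - s ^+ 2 by rewrite /c; field.
    by rewrite c2 subrr.
  have -> : a - (a / 2 + s) - (a / 2 - s) = 0 by field.
  by rewrite !scale0r addr0 eqxx.
pose s := Num.sqrt (- c).
have s2 : s ^+ 2 = - c by rewrite sqr_sqrtr ?oppr_ge0 ?ltW.
have s0 : s != 0 by rewrite sqrtr_eq0 -ltNge oppr_gt0.
exists (s^-1 *: (y - (a / 2)%:A)); split; first by rewrite memvZ.
- rewrite -scalerAl -scalerAr scalerA shiftM.
  have -> : a - a / 2 - a / 2 = 0 by field.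
  rewrite scale0r addr0 scalerA -[RHS]scaleN1r; congr (_ *: _).
  have -> : b + a / 2 * (a / 2) = - s ^+ 2 by rewrite s2 opprK /c; field.
  by field.
move=> x /yP[p [q ->]]; exists (p + q * (a / 2)), (q * s).
rewrite scalerA mulfK // scalerBr scalerA scalerDl -addrA.
by rewrite [X in _ = _ + X]addrC subrK.
Qed.

End IdentityComponent.

(** * The subgroup K and commutation with the imaginary unit *)

Section ImaginaryUnit.
Variables (R : realType) (G : zmodType) (D : falgType R).
Variable Gam : div_grading G D.
Local Notation T := (supp_type Gam).
Variable I : D.
Hypothesis I0 : I \in Gam 0.
Hypothesis II : I * I = - 1.
Hypothesis D0P : forall x, x \in Gam 0 -> exists p q : R, x = p%:A + q *: I.
Hypothesis centerP : forall z : D, (forall x, z * x = x * z) ->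
  exists a : R, z = a%:A.

Lemma complexM (p q p' q' : R) :
  (p%:A + q *: I) * (p'%:A + q' *: I) =
  (p * p' - q * q')%:A + (p * q' + q * p') *: I.
Proof.
rewrite mulrDl !mulrDr !mulr_algl mulr_algr -scalerAl -scalerAr II !scalerN.
rewrite !scalerA !scalerDl scaleNr (mulrC p' q) -!addrA; congr (_ + _).
by rewrite [RHS]addrC -!addrA; congr (_ + _).
Qed.

Lemma I_neq0 : I != 0.
Proof.
apply/eqP => E; move: II; rewrite E mul0r => /eqP.
by rewrite eq_sym oppr_eq0 oner_eq0.
Qed.

Lemma commI x y : x \in Gam 0 -> y * I = I * y -> x * y = y * x.
Proof.
move=> /D0P[p [q ->]] yI.
by rewrite mulrDl mulrDr mulr_algl mulr_algr -scalerAl -scalerAr yI.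
Qed.

Lemma anticommI p q x : x * I = - (I * x) ->
  x * (p%:A + q *: I) = (p%:A - q *: I) * x.
Proof.
by move=> xI; rewrite mulrDr mulrBl mulr_algr mulr_algl -scalerAr -scalerAl xI
  scalerN.
Qed.

(** Conjugation by [x] sends [I] to a square root [j] of -1 in the commutative identity component.
    There [(j - I) * (j + I) = 0], and nonzero elements are invertible. *)
Lemma comm_or_anticomm t x : x \in Gam t -> x != 0 ->
  x * I = I * x \/ x * I = - (I * x).
Proof.
move=> xt x0; have ux := div_grading_unit xt x0.
pose j := x * I * x^-1.
have j0 : j \in Gam 0.
  by have := gradM (gradM xt I0) (gradV xt x0); rewrite addr0 subrr.
have xI : x * I = j * x by rewrite /j mulrVK.
have jj : j * j = -1.
  by rewrite /j !mulrA mulrVK // -(mulrA x) II mulrN mulr1 mulNr divrr.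
have jI : (j - I) * (j + I) = 0.
  by rewrite mulrDr !mulrBl jj II opprK (commI j0 erefl) addrA subrK addNr.
rewrite xI; have [/subr0_eq ->|jI0] := eqVneq (j - I) 0; [by left|right].
have jI' : j - I \in Gam 0 by rewrite rpredB.
have [/eqP|/(gradM_neq0 jI' jI0)] := eqVneq (j + I) 0; last by rewrite jI eqxx.
by rewrite addr_eq0 => /eqP ->; rewrite mulNr.
Qed.

Lemma comm_anticomm0 x : x * I = I * x -> x * I = - (I * x) -> x = 0.
Proof.
move=> -> /eqP; rewrite -subr_eq0 opprK -mulr2n -scaler_nat scaler_eq0.
rewrite pnatr_eq0 /=; apply: contraTeq => x0; exact: gradM_neq0 I0 I_neq0 x0.
Qed.

Lemma same_degree t x y : x \in Gam t -> x != 0 -> y \in Gam t ->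
  exists2 c, c \in Gam 0 & y = c * x.
Proof.
move=> xt x0 yt; exists (y * x^-1); last by rewrite mulrVK ?(div_grading_unit xt).
by have := gradM yt (gradV xt x0); rewrite subrr.
Qed.

(** Membership in K can be tested on any one nonzero [x]: the other elements of its component are
    multiples of it by the commutative identity component. *)
Lemma suppKP (t : T) x : x \in Gam t -> x != 0 ->
  suppK t <-> x * I = I * x.
Proof.
move=> xt x0; split; rewrite /suppK /=.
  rewrite -vpick0; move: (memv_pick ('C(Gam 0%R) :&: Gam t)%VS).
  move: (vpick _) => w; rewrite memv_cap => /andP[/centvP wC wt] w0.
  have [c c0 ->] := same_degree wt w0 xt.
  by rewrite -mulrA wC // !mulrA (commI c0).
move=> xI; apply: contraNneq x0 => E; rewrite -memv0 -E memv_cap xt andbT.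
by apply/centvP => y y0; rewrite (commI y0).
Qed.

Lemma notKP (t : T) x : x \in Gam t -> x != 0 ->
  ~ suppK t <-> x * I = - (I * x).
Proof.
move=> xt x0; split=> [tK|xI /(suppKP xt x0) xI'].
  by case: (comm_or_anticomm xt x0) => // /(suppKP xt x0).
by move/eqP: x0; apply; apply: comm_anticomm0.
Qed.

Lemma suppK_commI (t : T) x : suppK t -> x \in Gam t -> x * I = I * x.
Proof.
move=> tK xt; have [->|x0] := eqVneq x 0; first by rewrite mul0r mulr0.
exact/(suppKP xt x0).
Qed.

Lemma suppKD (s t : T) : suppK t -> suppK (s + t) <-> suppK s.
Proof.
move=> tK; have [x xs x0] := supp_neq0 s; have [y yt y0] := supp_neq0 t.
have yI := suppK_commI tK yt.
have xyst : x * y \in Gam (s + t) by apply: gradM.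
have xy0 := gradM_neq0 xs x0 y0.
have [ux uy] := (div_grading_unit xs x0, div_grading_unit yt y0).
split=> [/(suppKP xyst xy0) E|/(suppKP xs x0) E].
  by apply/(suppKP xs x0)/(mulIr uy); rewrite -mulrA -yI mulrA E mulrA.
by apply/(suppKP xyst xy0); rewrite -mulrA yI !mulrA E.
Qed.

Lemma suppK_diff (s t : T) : ~ suppK s -> ~ suppK t -> suppK (s - t).
Proof.
move=> sK tK; have [x xs x0] := supp_neq0 s; have [y yt y0] := supp_neq0 t.
have uy := div_grading_unit yt y0.
have /(notKP xs x0) xI := sK; have /(notKP yt y0) yI := tK.
have yV : y^-1 * I = - (I * y^-1).
  by apply: (mulrI uy); rewrite mulVKr // mulrN !mulrA yI mulNr mulrK // opprK.
have xyst : x * y^-1 \in Gam (s - t) by apply: gradM => //; apply: gradV.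
apply/(suppKP xyst); first by apply: (gradM_neq0 xs x0); rewrite invr_eq0.
by rewrite -mulrA yV mulrN !mulrA xI mulNr opprK.
Qed.

(** Otherwise [I] would be central, hence a real number of square -1. *)
Lemma notK_exists : exists t : T, ~ suppK t.
Proof.
apply: contrapT => noK; have [a Ia] : exists a : R, I = a%:A.
  apply: centerP; apply: (grad_ind (Gam := Gam)) => [|x y xI yI|g x xg x0].
  - by rewrite mul0r mulr0.
  - by rewrite mulrDl mulrDr xI yI.
  have gS : g \in supp Gam by apply/suppP; exists x.
  apply/esym; apply: (@suppK_commI (SuppType gS)) => //.
  by apply: contrapT => gK; apply: noK; exists (SuppType gS).
have /eqP := II; rewrite Ia mulr_algl scalerA -scaleN1r -subr_eq0 -scalerBl.
rewrite scaler_eq0 oner_eq0 orbF opprK => /eqP E.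
have := sqr_ge0 a; rewrite expr2 leNgt => /negP; apply.
by rewrite -(ltrD2r 1) E add0r ltr01.
Qed.

(** * Squares of, and conjugation by, an element of degree outside K *)

Section AnticommutingElement.
Variables (u : T) (X : D).
Hypothesis uK : ~ suppK u.
Hypothesis Xu : X \in Gam u.
Hypothesis X0 : X != 0.

Let uX : X \is a GRing.unit := div_grading_unit Xu X0.
Let XI : X * I = - (I * X).
Proof. exact/(notKP Xu X0). Qed.

Lemma XX_I : X * X * I = I * (X * X).
Proof. by rewrite -mulrA XI mulrN !mulrA XI mulNr opprK. Qed.

(* Conjugation by [X] multiplies [Y] by some [c] in [D_e]; [X * X] then multiplies
   it by [|c|^2], which is a root of unity because [T] is a torsion group. *)
Lemma conj_homogeneous k Y : Y \in Gam k -> Y != 0 -> Y * I = I * Y ->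
  exists p q : R, [/\ X * Y = (p%:A + q *: I) * (Y * X),
    p ^+ 2 + q ^+ 2 = 1 & X * X * Y = Y * (X * X)].
Proof.
move=> Yk Y0 YI; have uY := div_grading_unit Yk Y0.
have XYuk : X * Y \in Gam (k + (u : G)) by rewrite addrC gradM.
have [c /D0P[p [q ->]] XY] :=
  same_degree (gradM Yk Xu) (gradM_neq0 Yk Y0 X0) XYuk.
exists p, q.
have XXY : X * X * Y = (p ^+ 2 + q ^+ 2) *: (Y * (X * X)).
  rewrite -mulrA XY mulrA (anticommI _ _ XI) -mulrA (mulrA X Y) XY.
  rewrite -(mulrA _ (Y * X)) -(mulrA Y) mulrA -scaleNr complexM.
  have -> : p * p - - q * q = p ^+ 2 + q ^+ 2 by ring.
  have -> : p * q + - q * p = 0 by ring.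
  by rewrite scale0r addr0 mulr_algl.
suff r1 : p ^+ 2 + q ^+ 2 = 1 by split=> //; rewrite XXY r1 scale1r.
set r := _ + _ in XXY *.
have XXYn n : X * X * Y ^+ n = r ^+ n *: (Y ^+ n * (X * X)).
  elim: n => [|n IH]; first by rewrite !expr0 scale1r mul1r mulr1.
  rewrite exprS mulrA XXY -scalerAl -(mulrA Y (X * X)) IH -scalerAr scalerA.
  by rewrite (mulrA Y (Y ^+ n)) -!exprS.
have kS : k \in supp Gam by apply/suppP; exists Y.
have [n n0 nk] := supp_torsion kS.
have Yn m : Y ^+ m \in Gam (k *+ m).
  by elim: m => [|m IH]; [apply: grad1 | rewrite exprS mulrS gradM].
have Yn0 : Y ^+ n \in Gam 0 by rewrite -nk.
(* [Y ^+ n] lies in the identity component, so it commutes with [X * X]; hence [r ^+ n = 1], and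
   [r = 1] as [r] is nonnegative. *)
have /esym/eqP := XXYn n.
rewrite (commI Yn0 XX_I) -subr_eq0 -{2}[X * X * _]scale1r.
rewrite -scalerBl scaler_eq0 subr_eq0.
have /negPf -> : X * X * Y ^+ n != 0.
  apply/eqP => E; have : X * X * Y ^+ n \is a GRing.unit.
    by rewrite !unitrMl ?unitrX.
  by rewrite E unitr0.
by rewrite orbF pexpr_eq1 // ?addr_ge0 ?sqr_ge0 // => /eqP.
Qed.

(** [X * X] commutes with every homogeneous [W], hence is real. If [W] anticommutes with [I], then
    [X * W] commutes with [I], and [X] is cancelled afterwards. *)
Lemma sqr_anticomm : exists2 a : R, a != 0 & X * X = a%:A.
Proof.
have XX0 := gradM_neq0 Xu X0 X0.
suff [a Ea] : exists a : R, X * X = a%:A.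
  by exists a => //; apply: contraNneq XX0 => a0; rewrite Ea a0 scale0r.
apply: centerP; apply: (grad_ind (Gam := Gam)) => [|x y xC yC|g W Wg W0].
- by rewrite mul0r mulr0.
- by rewrite mulrDl mulrDr xC yC.
have [WI|WI] := comm_or_anticomm Wg W0.
  by have [p [q []]] := conj_homogeneous Wg W0 WI.
have XWI : X * W * I = I * (X * W).
  by rewrite -mulrA WI mulrN !mulrA XI mulNr opprK.
have [p [q [_ _]]] := conj_homogeneous (gradM Xu Wg) (gradM_neq0 Xu X0 W0) XWI.
by rewrite -!mulrA => /(mulrI uX); rewrite !mulrA.
Qed.

Lemma comm_representative (k : T) : suppK k ->
  exists Z, [/\ Z \in Gam k, Z != 0, Z * I = I * Z & Z * X = X * Z].
Proof.
move=> kK; have [Y Yk Y0] := supp_neq0 k; have YI := suppK_commI kK Yk.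
have [p [q [XY pq1 _]]] := conj_homogeneous Yk Y0 YI.
have mk (a : D) : a \in Gam 0 -> a != 0 -> X * (a * Y) = a * Y * X ->
    exists Z, [/\ Z \in Gam k, Z != 0, Z * I = I * Z & Z * X = X * Z].
  move=> a0 aN0 aYX; exists (a * Y); split=> //.
  - by have := gradM a0 Yk; rewrite add0r.
  - exact: gradM_neq0 a0 aN0 Y0.
  - by rewrite -mulrA YI !mulrA (commI a0).
have aE (s t : R) : s%:A + t *: I \in Gam 0 by rewrite rpredD ?gradA ?memvZ.
have [c1|c1] := eqVneq ((p + 1)%:A + q *: I) 0; last first.
  apply: (mk _ (aE _ _) c1); rewrite mulrA (anticommI _ _ XI) -(mulrA _ X Y) XY.
  rewrite mulrA -scaleNr complexM mulrA.
  have -> : (p + 1) * p - - q * q = p + 1.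
    have -> : (p + 1) * p - - q * q = (p ^+ 2 + q ^+ 2) + p by ring.
    by rewrite pq1 addrC.
  by have -> : (p + 1) * q + - q * p = q by ring.
apply: (mk _ I0 I_neq0); have pqN1 : p%:A + q *: I = - 1.
  by apply/eqP; rewrite -addr_eq0 addrAC -[X in _ + X + _]scale1r -scalerDl c1.
by rewrite mulrA XI mulNr -(mulrA I X) XY pqN1 mulN1r mulrN opprK mulrA.
Qed.

(** Write [Y] as a complex multiple of [X]; moving [X] past the factor conjugates it, so [r] is its
    squared modulus. *)
Lemma sqr_same_degree Y : Y \in Gam u -> Y != 0 ->
  exists2 r : R, 0 < r & Y * Y = r *: (X * X).
Proof.
move=> Yu Y0; have [_ /D0P[p [q ->]] YE] := same_degree Xu X0 Yu.
have YY : Y * Y = (p ^+ 2 + q ^+ 2) *: (X * X).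
  rewrite YE mulrA -(mulrA _ X) (anticommI _ _ XI) mulrA -scaleNr complexM.
  have -> : p * p - q * - q = p ^+ 2 + q ^+ 2 by ring.
  have -> : p * - q + q * p = 0 by ring.
  by rewrite scale0r addr0 -mulrA mulr_algl.
exists (p ^+ 2 + q ^+ 2) => //; rewrite lt_def addr_ge0 ?sqr_ge0 // andbT.
by apply: contraNneq (gradM_neq0 Yu Y0 Y0) => r0; rewrite YY r0 scale0r.
Qed.

End AnticommutingElement.

(** The set in the definition of [nu] is nonempty, so [xget] does not fall back on 0: the sign of
    the real number [X * X] belongs to it. *)
Lemma nuP (u : T) : ~ suppK u -> (nu u = 1 \/ nu u = -1) /\
  forall X, X \in Gam u -> X != 0 ->
    exists2 r : R, 0 < r & X ^+ 2 = ((nu u)%:~R * r)%:A.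
Proof.
move=> uK; have [X Xu X0] := supp_neq0 u.
have [a a0 XX] := sqr_anticomm uK Xu X0.
suff : [set s : int | (s = 1 \/ s = -1) /\
    forall X, X \in Gam u -> X != 0 ->
      exists2 r : R, 0 < r & X ^+ 2 = (s%:~R * r)%:A] (nu u) by [].
apply: xgetPex; exists (sgz a); split.
  by rewrite /sgz (negPf a0); case: ifP; [right | left].
move=> Y Yu Y0; have [r r0 YY] := sqr_same_degree uK Xu X0 Yu Y0.
exists (r * `|a|); first by rewrite mulr_gt0 ?normr_gt0.
rewrite expr2 YY XX scalerA; congr (_%:A).
by rewrite -sgrEz mulrCA -numEsg.
Qed.

(** For [u] outside K and [k] in K, this is the sign of [Z * Z] for a nonzero [Z] of degree [k]
    commuting with [I] and with some nonzero [X] of degree [u], because the square of [X * Z] is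
    [X * X * (Z * Z)]. *)
Definition nu_quad (u k : T) : R := (nu u * nu (u + k))%:~R.

Lemma nu_quad_sqr (u k : T) : ~ suppK u -> suppK k -> nu_quad u k ^+ 2 = 1.
Proof.
move=> uK kK; have ukK : ~ suppK (u + k) by move/(suppKD _ kK).
have [+ _] := nuP uK; have [+ _] := nuP ukK; rewrite /nu_quad.
by case=> ->; case=> ->;
  rewrite ?mulr1 ?mul1r ?mulN1r ?opprK ?rmorphN ?rmorph1 ?sqrrN ?expr1n.
Qed.

Lemma eq1_mul_pos (e e' r : R) : e ^+ 2 = 1 -> e' ^+ 2 = 1 -> 0 < r ->
  e = e' * r -> r = 1.
Proof.
move=> e1 e'1 r0 E; apply/eqP; rewrite -(pexpr_eq1 (n := 2)) ?ltW //.
by rewrite -e1 E exprMn e'1 mul1r.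
Qed.

(** * Normalized representatives and their commutation signs *)

Section Normalized.
Variables (u : T) (X : D).
Hypothesis uK : ~ suppK u.
Hypothesis Xu : X \in Gam u.
Hypothesis X0 : X != 0.
Hypothesis XX : X * X = ((nu u)%:~R : R)%:A.

Let nuu2 : ((nu u)%:~R : R) ^+ 2 = 1.
Proof.
by have [[->|->] _] := nuP uK; rewrite ?rmorphN rmorph1 ?sqrrN expr1n.
Qed.

Definition rep_spec (k : T) (Z : D) :=
  [/\ Z \in Gam k, Z != 0, Z * I = I * Z & Z * X = X * Z].

Lemma rep_sqr (k : T) Z : suppK k -> rep_spec k Z ->
  exists2 r : R, 0 < r & Z * Z = (nu_quad u k * r)%:A.
Proof.
move=> kK [Zk Z0 ZI ZX]; have ukK : ~ suppK (u + k) by move/(suppKD _ kK).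
have XZuk : X * Z \in Gam (u + k) by apply: gradM.
have [_ /(_ _ XZuk (gradM_neq0 Xu X0 Z0))[r r0]] := nuP ukK.
rewrite expr2 -mulrA (mulrA Z) ZX -(mulrA X Z) mulrA XX mulr_algl => E.
exists r => //; rewrite -[LHS]scale1r -[X in X *: _ = _]nuu2 expr2.
rewrite -[LHS]scalerA E scalerA mulrA.
by rewrite /nu_quad rmorphM.
Qed.

Lemma normalized_rep (k : T) : suppK k ->
  exists2 Z, rep_spec k Z & Z * Z = (nu_quad u k)%:A.
Proof.
move=> kK; have [Z Zrep] := comm_representative uK Xu X0 kK.
have [r r0 ZZ] := rep_sqr kK Zrep; have [Zk Z0 ZI ZX] := Zrep.
have s0 : Num.sqrt r != 0 by rewrite sqrtr_eq0 -ltNge.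
exists ((Num.sqrt r)^-1 *: Z).
  split; first by rewrite memvZ.
  - by rewrite scaler_eq0 invr_eq0 negb_or s0.
  - by rewrite -scalerAl -scalerAr ZI.
  - by rewrite -scalerAl -scalerAr ZX.
rewrite -scalerAl -scalerAr scalerA ZZ scalerA; congr (_%:A).
by rewrite -invfM -expr2 sqr_sqrtr ?ltW // mulrCA mulVf ?mulr1 ?gt_eqF.
Qed.

(** The commutation sign is the polarization of [nu_quad u]: the product of [Y * Z] with [Z * Y] is
    known from the squares of [Y] and [Z], and the square of [Y * Z] from [rep_sqr], up to a
    positive factor [r] to be shown equal to 1. *)
Lemma normalized_rep_comm (k l : T) Y Z : suppK k -> suppK l ->
  rep_spec k Y -> rep_spec l Z ->
  Y * Y = (nu_quad u k)%:A -> Z * Z = (nu_quad u l)%:A ->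
  Y * Z = (nu_quad u k * nu_quad u l * nu_quad u (k + l)) *: (Z * Y).
Proof.
move=> kK lK Yk Zl YY ZZ; have klK : suppK (k + l) by apply/(suppKD _ lK).
have rep : rep_spec (k + l) (Y * Z).
  case: Yk Zl => [Yk Y0 YI YX] [Zl Z0 ZI ZX]; split.
  - exact: gradM.
  - exact: gradM_neq0 Yk Y0 Z0.
  - by rewrite -mulrA ZI !mulrA YI.
  - by rewrite -mulrA ZX !mulrA YX.
have [r r0 WW] := rep_sqr klK rep; pose s := nu_quad u (k + l) * r.
have uY : Y \is a GRing.unit.
  by case: Yk => Yk Y0 _ _; apply: div_grading_unit Yk Y0.
have WV : Y * Z * (Z * Y) = (nu_quad u k * nu_quad u l)%:A.
  by rewrite -mulrA (mulrA Z) ZZ mulr_algl -scalerAr YY scalerA mulrC.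
have WWV : (nu_quad u k * nu_quad u l) *: (Y * Z) = s *: (Z * Y).
  by rewrite -mulr_algr -WV (mulrA (Y * Z) (Y * Z)) WW mulr_algl.
(* [Z * Y] is conjugate to [Y * Z] by [Y], so both have the same real square. *)
have VV : Z * Y * (Z * Y) = s%:A.
  apply: (mulrI uY).
  have -> : Y * (Z * Y * (Z * Y)) = Y * Z * (Y * Z) * Y by rewrite !mulrA.
  by rewrite WW mulr_algl mulr_algr.
(* Multiplying [WWV] by [Z * Y] compares [s ^+ 2] with the square of a product of signs. *)
have s2 : s ^+ 2 = 1.
  have /(congr1 (fun x => x * (Z * Y))) := WWV.
  rewrite -!scalerAl WV VV !scalerA => /eqP; rewrite -subr_eq0 -scalerBl.
  rewrite scaler_eq0 oner_eq0 orbF subr_eq0 -!expr2 => /eqP <-.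
  by rewrite exprMn !nu_quad_sqr // mul1r.
have r1 : r = 1 by apply: eq1_mul_pos s2 (nu_quad_sqr uK klK) r0 erefl.
rewrite -scalerA; move: WWV; rewrite /s r1 mulr1 => <-.
by rewrite scalerA -expr2 exprMn !nu_quad_sqr // mul1r scale1r.
Qed.

End Normalized.

Lemma normalized_exists (u : T) : ~ suppK u ->
  exists X, [/\ X \in Gam u, X != 0 & X * X = ((nu u)%:~R : R)%:A].
Proof.
move=> uK; have [X Xu X0] := supp_neq0 u.
have [_ /(_ _ Xu X0)[r r0 XX]] := nuP uK.
have s0 : Num.sqrt r != 0 by rewrite sqrtr_eq0 -ltNge.
exists ((Num.sqrt r)^-1 *: X); split; first by rewrite memvZ.
  by rewrite scaler_eq0 invr_eq0 negb_or s0.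
rewrite -scalerAl -scalerAr scalerA -(expr2 X) XX scalerA; congr (_%:A).
by rewrite -invfM -expr2 sqr_sqrtr ?ltW // mulrCA mulVf ?mulr1 ?gt_eqF.
Qed.

End ImaginaryUnit.

(** * The Weyl group *)

Section WeylGroup.
Variables (R : realType) (G : zmodType) (D : falgType R).
Variable Gam : div_grading G D.
Local Notation T := (supp_type Gam).

(** A description of K by products alone, which algebra automorphisms transport. *)
Lemma suppKE (t : T) : suppK t <-> exists x,
  [/\ x \in Gam t, x != 0 & forall y, y \in Gam 0 -> x * y = y * x].
Proof.
split; rewrite /suppK /=.
  rewrite -vpick0; move: (memv_pick ('C(Gam 0%R) :&: Gam t)%VS).
  move: (vpick _) => x; rewrite memv_cap => /andP[/centvP xC xt] x0.
  by exists x.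
case=> x [xt x0 xC]; apply: contraNneq x0 => E; rewrite -memv0 -E memv_cap xt.
by rewrite andbT; apply/centvP.
Qed.

Lemma autT0 (f : T -> T) : autT Gam f -> f 0 = 0.
Proof. by case=> _ fD; apply: (addrI (f 0)); rewrite -fD !addr0. Qed.

Lemma weyl_aut_sub : weyl_aut Gam `<=` autTKnu Gam.
Proof.
move=> f [w ww wf]; have [f' f'A wf'] := weyl_acts_exists ww.
have [psi [psi_bij _] Ew] := ww.
have psiw : w psi.
  rewrite -Ew; exists \1%AF; last first.
    by apply: aend_ext => x; rewrite aend_compE id_lfunE.
  by split=> [|g]; [exists id => x; rewrite id_lfunE | rewrite lim1g].
have fA : autT Gam f.
  suff -> : f = f' by [].
  by apply: funext => t; apply: component_inj; rewrite -(wf psi) // -(wf' psi).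
have psi_inj := bij_inj psi_bij.
have psi0 x : (psi x != 0) = (x != 0).
  by rewrite -{1}(linear0 psi) (inj_eq psi_inj).
have memE t x : x \in Gam (f t) -> exists2 y, y \in Gam t & x = psi y.
  by rewrite -(wf psi) // => /memv_imgP[y]; exists y.
have memI (t : T) x : x \in Gam t -> psi x \in Gam (f t).
  by move=> xt; rewrite -(wf psi) // memv_img.
have f0 := autT0 fA.
have KE t : suppK (f t) <-> suppK t.
  rewrite !suppKE; split=> [[x [/memE[y yt ->] y0 yC]]|[x [xt x0 xC]]].
    exists y; rewrite -psi0; split=> // z z0; apply: psi_inj.
    by rewrite !rmorphM yC // -[0]/(val (0 : T)) -f0 memI.
  exists (psi x); rewrite psi0 memI //; split=> // y.
  by rewrite -[0]/(val (0 : T)) -f0 => /memE[z z0 ->]; rewrite -!rmorphM xC.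
split=> // [|u _].
  apply/seteqP; split=> [_ [t tK <-]|t tK]; first exact/KE.
  have [[g _ gK] _] := fA; exists (g t); last exact: gK.
  by apply/KE; rewrite gK.
(* Both values of [nu] are chosen from sets of signs, and transport along [psi] shows these sets to
   be equal. *)
congr (xget 0 _); apply/seteqP; split=> s [s1 sP]; split=> // x xu x0.
  have [r r0 E] := sP _ (memI _ _ xu) (etrans (psi0 x) x0).
  exists r => //; apply: psi_inj; rewrite rmorphXn E.
  by rewrite linearZ rmorph1.
have [y yu Ex] := memE _ _ xu; move: x0; rewrite Ex psi0 => y0.
have [r r0 E] := sP _ yu y0; exists r => //.
by have := congr1 psi E; rewrite rmorphXn linearZ rmorph1.
Qed.

Hypothesis D_simple : simple_alg D.
Hypothesis centerP : forall z : D, (forall x, z * x = x * z) ->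
  exists a : R, z = a%:A.
Hypothesis dim_component : forall g, Gam g != 0%VS -> \dim (Gam g) = 2%N.

Lemma intertwiner (f : T -> T) : autTKnu Gam f -> exists2 v : D, v != 0 &
  forall (t : T) d, d \in Gam t -> exists2 b, b \in Gam (f t) & v * d = b * v.
Proof.
move=> fA; have [fT fK fnu] := fA; have [[g gf fg] fD] := fT.
have f0 := autT0 fT.
have KI t : suppK t -> suppK (f t) by move=> tK; rewrite -fK; exists t.
have KN t : ~ suppK t -> ~ suppK (f t).
  by move=> tK; rewrite -fK => -[s sK /(can_inj gf) Est]; apply: tK; rewrite -Est.
have [I [I0 II D0P]] : exists I, [/\ I \in Gam 0, I * I = - 1 &
    forall x, x \in Gam 0 -> exists p q : R, x = p%:A + q *: I].
  apply: identity_component_complex; apply: dim_component.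
  by have := (supp_zmod_closed Gam).1; rewrite unfold_in.
have [u uK] := notK_exists I0 II D0P centerP.
have fuK := KN _ uK.
have [X [Xu X0 XX]] := normalized_exists I0 II D0P centerP uK.
have [X' [X'u X'0 XX']] := normalized_exists I0 II D0P centerP fuK.
(* Both [u] and [u + k] lie outside K, where [f] preserves [nu]. *)
have nu_quadf k : suppK k -> nu_quad (f u) (f k) = nu_quad u k.
  move=> kK; rewrite /nu_quad -fD !fnu //.
  by rewrite (suppKD I0 D0P _ kK).
have /choice[Z ZP] : forall k, exists Z, suppK k ->
    rep_spec I X k Z /\ Z * Z = (nu_quad u k)%:A.
  move=> k; have [kK|nK] := pselect (suppK k); last by exists 0.
  by have [Z] := normalized_rep I0 II D0P centerP uK Xu X0 XX kK; exists Z.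
have /choice[Z' Z'P] : forall k, exists Z, suppK k ->
    rep_spec I X' (f k) Z /\ Z * Z = (nu_quad u k)%:A.
  move=> k; have [kK|nK] := pselect (suppK k); last by exists 0.
  have [Z' Z'1] := normalized_rep I0 II D0P centerP fuK X'u X'0 XX' (KI _ kK).
  by rewrite nu_quadf //; exists Z'.
have [l lE] := supp_finite Gam.
pose lT : seq T := pmap insub l.
have lTE (t : T) : t \in lT by rewrite mem_pmap_sub lE; case: (t).
pose S := (I, I) :: (X, X') :: [seq (Z t, Z' t) | t <- lT & `[< suppK t >]].
have SP p : p \in S -> [\/ p = (I, I), p = (X, X') |
    exists2 t, suppK t & p = (Z t, Z' t)].
  rewrite !inE => /or3P[/eqP->|/eqP->|/mapP[t]].
  - by constructor 1.
  - by constructor 2.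
  by rewrite mem_filter => /andP[/asboolP tK _ ->]; constructor 3; exists t.
have sign1 : (1 : R) ^+ 2 = 1 by rewrite expr1n.
have signN1 : (- 1 : R) ^+ 2 = 1 by rewrite sqrrN expr1n.
have anti (t : T) Y : ~ suppK t -> Y \in Gam t -> Y * I = - (I * Y).
  move=> tK Yt; have [->|Y0] := eqVneq Y 0; first by rewrite mul0r mulr0 oppr0.
  exact/(notKP I0 II D0P Yt Y0).
have [||v v0 vS] := @twisted_eigenvector _ _ S.
- move=> _ /SP[->|->|[t tK ->]] /=.
  + by exists (-1); rewrite scaleN1r.
  + exists (nu u)%:~R; rewrite XX XX' fnu //; split=> //.
    by have [[->|->] _] := nuP I0 II D0P centerP uK; rewrite ?rmorphN rmorph1.
  + exists (nu_quad u t); have [_ ->] := ZP _ tK; have [_ ->] := Z'P _ tK.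
    by rewrite (nu_quad_sqr I0 II D0P centerP).
- move=> _ _ /SP[->|->|[s sK ->]] /SP[->|->|[t tK ->]] /=.
  + by exists 1; rewrite scale1r.
  + by exists (-1); rewrite !scaleN1r (anti _ _ uK Xu) (anti _ _ fuK X'u) !opprK.
  + have [[_ _ ZI _] _] := ZP _ tK; have [[_ _ Z'I _] _] := Z'P _ tK.
    by exists 1; rewrite !scale1r ZI Z'I.
  + by exists (-1); rewrite !scaleN1r (anti _ _ uK Xu) (anti _ _ fuK X'u).
  + by exists 1; rewrite !scale1r.
  + have [[_ _ _ ZI] _] := ZP _ tK; have [[_ _ _ Z'I] _] := Z'P _ tK.
    by exists 1; rewrite !scale1r ZI Z'I.
  + have [[_ _ ZI _] _] := ZP _ sK; have [[_ _ Z'I _] _] := Z'P _ sK.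
    by exists 1; rewrite !scale1r ZI Z'I.
  + have [[_ _ _ ZI] _] := ZP _ sK; have [[_ _ _ Z'I] _] := Z'P _ sK.
    by exists 1; rewrite !scale1r ZI Z'I.
  have [Zs sqs] := ZP _ sK; have [Zt sqt] := ZP _ tK.
  have [Z's sqs'] := Z'P _ sK; have [Z't sqt'] := Z'P _ tK.
  have stK : suppK (s + t) by apply/(suppKD I0 D0P _ tK).
  exists (nu_quad u s * nu_quad u t * nu_quad u (s + t)); split.
  + by rewrite !exprMn !(nu_quad_sqr I0 II D0P centerP) // !mul1r.
  + exact: (normalized_rep_comm I0 II D0P centerP uK Xu X0 XX sK tK).
  (* On the primed side the sign comes from [f u] and the images of [s], [t] and [s + t]; [nu_quadf]
     identifies it with the unprimed one. *)
  rewrite -!nu_quadf // in sqs' sqt' *; rewrite fD.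
  exact: (normalized_rep_comm I0 II D0P centerP fuK X'u X'0 XX'
           (KI _ sK) (KI _ tK)).
have vP x y : (x, y) \in S -> exists e : R, v * x = e *: y * v.
  move=> /vS[e e2 /= E]; exists e.
  by rewrite -scalerAl E scalerA -expr2 e2 scale1r.
(* The relation passes from generators to components in three stages: the identity component,
   spanned by 1 and [I]; degrees [k] in K, multiples of [Z k]; and degrees [t] outside K, where
   [X^-1 * d] has degree [t - u] in K. *)
have vD0 d : d \in Gam 0 -> exists2 b, b \in Gam 0 & v * d = b * v.
  move=> /D0P[p [q ->]]; have [e E] := vP I I (mem_head _ _).
  exists (p%:A + (q * e) *: I); first by rewrite rpredD ?gradA ?memvZ.
  by rewrite mulrDr mulrDl mulr_algr mulr_algl -scalerAr E -scalerA scalerAl.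
have vDK (k : T) d : suppK k -> d \in Gam k ->
    exists2 b, b \in Gam (f k) & v * d = b * v.
  move=> kK dk; have [[Zk Z0 _ _] _] := ZP _ kK; have [[Z'k _ _ _] _] := Z'P _ kK.
  have [c /vD0[c' c'0 cE] ->] := same_degree Zk Z0 dk.
  have [e E] : exists e : R, v * Z k = e *: Z' k * v.
    apply: vP; rewrite !inE; apply/or3P/Or33/mapP; exists k => //.
    by rewrite mem_filter lTE andbT; apply/asboolP.
  exists (c' * (e *: Z' k)).
    by have := gradM c'0 (memvZ e Z'k); rewrite add0r.
  by rewrite mulrA cE -(mulrA c' v) E mulrA.
exists v => // t d dt; have [tK|tK] := pselect (suppK t); first exact: vDK.
have uX := div_grading_unit Xu X0.
have [e E] : exists e : R, v * X = e *: X' * v.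
  by apply: vP; rewrite !inE eqxx orbT.
have [|b bK bE] := vDK (t - u) (X^-1 * d) (suppK_diff I0 II D0P tK uK).
  by have := gradM (gradV Xu X0) dt; rewrite addrC.
exists (e *: X' * b).
  have -> : f t = f u + f (t - u) by rewrite -fD addrC subrK.
  by apply: gradM => //; rewrite memvZ.
by rewrite -(mulVKr uX d) (mulrA v X) E -(mulrA _ v) bE mulrA.
Qed.

Lemma weyl_aut_sup : autTKnu Gam `<=` weyl_aut Gam.
Proof.
move=> f fA; have [v v0 vf] := intertwiner fA.
have uv : v \is a GRing.unit.
  apply: simple_twisted_unit => //.
  apply: (grad_ind (Gam := Gam)) => [|x y [b E] [c F]|g x xg x0].
  - by exists 0; rewrite mulr0 mul0r.
  - by exists (b + c); rewrite mulrDr E F mulrDl.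
  have gS : g \in supp Gam by apply/suppP; exists x.
  by have [b _ E] := vf (SuppType gS) x xg; exists b.
pose conjv := (amulr (v^-1)%R \o amull v)%VF.
have phiE d : conjv d = v * d * v^-1.
  by rewrite comp_lfunE !lfunE.
have phiP : ahom_in {:D} conjv.
  apply/ahom_inP; split=> [x y _ _|]; rewrite !phiE ?mulr1 ?divrr //.
  by rewrite !mulrA mulrVK.
pose psi : 'AEnd(D) := AHom phiP.
have psiE d : psi d = v * d * v^-1 by apply: phiE.
have psi_bij : bijective psi.
  exists (fun d => v^-1 * d * v) => d; rewrite !psiE !mulrA.
    by rewrite mulVr // mul1r mulrVK.
  by rewrite divrr // mul1r mulrK.
have ker0 : lker psi == 0%VS by apply/lker0P/bij_inj.
have psif (t : T) : (psi @: Gam t)%VS = Gam (f t).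
  have sN0 (s : T) : Gam s != 0%VS by case: s.
  (* Conjugation maps one component into the other; both have dimension 2, so the inclusion is an
     equality. *)
  apply/eqP; rewrite eqEdim dim_component //.
  rewrite limg_dim_eq ?dim_component ?(eqP ker0) ?capv0 // andbT.
  apply/subvP => _ /memv_imgP[d dt ->]; have [b bt E] := vf t d dt.
  by rewrite psiE E mulrK.
exists (stab_coset Gam psi); last first.
  by move=> _ [sig [_ sigE] <-] t; rewrite limg_comp sigE psif.
exists psi => //; split=> // g.
have [gS|] := boolP (g \in supp Gam).
  by exists (f (SuppType gS)); rewrite -psif.
by rewrite negbK => /eqP g0; exists g; rewrite g0 limg0.
Qed.

End WeylGroup.

Theorem mainTheorem9 (R : realType) (G : zmodType) (D : falgType R)
    (Gam : div_grading G D) (n m : nat)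
    (D_simple : simple_alg D)
    (n_pow2 : n = (2 ^ m)%N) (n_ge2 : (2 <= n)%N)
    (D_iso : iso_quat_matrix D (n %/ 2)%N)
    (dim_component : forall g : G, Gam g != 0%VS -> \dim (Gam g) = 2%N) :
  weyl_aut Gam = autTKnu Gam.
Proof.
apply/seteqP; split; first exact: weyl_aut_sub.
(* As [n] is at least 2, the matrix size is positive, so the center of [D] is real. *)
apply: weyl_aut_sup => //; apply: iso_quat_matrix_center D_iso.
by rewrite divn_gt0.
Qed.
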